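(* Radon curves are projectively self-dual: if $\gamma\subset U$ is a Radon curve in a two-dimensional real vector space $U$, regarded as an affine chart of $\mathbb{RP}^2$, then $\gamma$ is a self-dual curve in $\mathbb{RP}^2$.
   Context: Let $U$ be a Minkowski plane (a two-dimensional real normed space) whose unit circle $\gamma$ is a closed smooth strictly convex centrally symmetric curve centered at the origin. For a vector $u\in\gamma$, its orthogonal complement is the (direction of the) tangent line to $\gamma$ at $u$: thus $u$ is orthogonal to $v$ if $v$ is parallel to the tangent line to $\gamma$ at $u$. This relation, extended to all non-zero vectors by scaling, is not symmetric in general. If it is symmetric, $U$ is called a Radon plane and $\gamma$ a Radon curve. Let $P=\mathbb{RP}^2$ be the projectivization of $V=\mathbb R^3$ and $P^*$ the projectivization of $V^*$. For a closed curve $\gamma(t)\subset P$, $t\in S^1$, the dual curve $\gamma^*(t)\in P^*$ is the annihilator of the tangent line to $\gamma$ at $\gamma(t)$. The curve $\gamma$ is (projectively) self-dual if there exist a projective isomorphism $g\colon P\to P^*$ and a diffeomorphism $\varphi$ of $S^1$ such that $g(\gamma(\varphi(t)))=\gamma^*(t)$ for all $t$. *)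

(* Defs.v *)
From HB Require Import structures.
From mathcomp Require Import all_boot all_order all_algebra.
From mathcomp Require Import all_classical all_reals all_analysis.

Set Implicit Arguments.
Unset Strict Implicit.
Unset Printing Implicit Defensive.

Import Order.TTheory GRing.Theory Num.Theory.
Import numFieldNormedType.Exports.

Local Open Scope classical_set_scope.
Local Open Scope ring_scope.

Definition smooth (R : realType) (W : normedModType R) (f : R -> W) : Prop :=
  forall (n : nat) (t : R), derivable (derive1n n f) t 1.

(* S^1 is R/Z: a map on S^1 is a 1-periodic map on R, and a diffeomorphism of
   S^1 is given by a lift to R, of degree 1 or -1.  Since psi inverts phi, it
   satisfies the same translation rule, hence descends to R/Z as well. *)
Definition circle_diffeo (R : realType) (phi : R -> R) : Prop :=
  [/\ smooth phi,
      exists psi : R -> R, [/\ smooth psi, cancel phi psi & cancel psi phi] &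
      (forall t, phi (t + 1) = phi t + 1) \/
      (forall t, phi (t + 1) = phi t - 1)].

Section MinkowskiPlane.
Variables (R : realType) (U : normedModType R).

(* normedModType carries no dimension. *)
Definition two_dimensional : Prop :=
  exists e1 e2 : U, forall u : U,
    exists! ab : R * R, u = ab.1 *: e1 + ab.2 *: e2.

(* gamma is a regular simple smooth parametrization by R/Z of the unit circle
   of U; the centre and the central symmetry come from the norm. *)
Definition unit_circle_param (gamma : R -> U) : Prop :=
  [/\ smooth gamma,
      forall t, derive1 gamma t != 0,
      forall t, gamma (t + 1) = gamma t,
      forall s t, gamma s = gamma t -> exists k : int, s = t + k%:~R &
      range gamma = [set u | `|u| = 1]].

Definition strictly_convex_norm : Prop :=
  forall (u v : U) (l : R), `|u| = 1 -> `|v| = 1 -> u != v -> 0 < l < 1 ->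
    `|l *: u + (1 - l) *: v| < 1.

Definition orthogonal_to (gamma : R -> U) (u v : U) : Prop :=
  [/\ u != 0, v != 0 &
      exists t a b : R, u = a *: gamma t /\ v = b *: derive1 gamma t].

Definition radon_curve (gamma : R -> U) : Prop :=
  [/\ unit_circle_param gamma,
      strictly_convex_norm &
      forall u v, orthogonal_to gamma u v -> orthogonal_to gamma v u].

End MinkowskiPlane.

(* V is the linear model of the projective plane: points of P and P^* are the
   lines <[v]>, v != 0, of V and of its dual. *)
Section Dual.
Variables (R : fieldType) (V : vectType R).

Definition dual_space : vectType R := 'Hom(V, R^o).

(* projv W projects V onto W, so f \o projv W is zero iff f vanishes on W. *)
Definition restrict_form (W : {vspace V}) (f : 'Hom(V, R^o)) : 'Hom(V, R^o) :=
  (f \o projv W)%VF.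

Fact restrict_form_is_linear W : linear (restrict_form W).
Proof.
by move=> k f h; rewrite /restrict_form comp_lfunDl comp_lfunZl.
Qed.

HB.instance Definition _ (W : {vspace V}) :=
  GRing.isLinear.Build R 'Hom(V, R^o) 'Hom(V, R^o) _ (restrict_form W)
    (restrict_form_is_linear W).

Definition annihilator (W : {vspace V}) : {vspace dual_space} :=
  lker (linfun (restrict_form W)).

Lemma mem_annihilator (W : {vspace V}) (f : 'Hom(V, R^o)) :
  (f \in annihilator W) = (W <= lker f)%VS.
Proof.
rewrite memv_ker lfunE /=; apply/eqP/subvP => [fW w wW | fW].
  have := comp_lfunE f (projv W) w.
  by rewrite projv_id // -/(restrict_form W f) fW zero_lfunE memv_ker => <-.
apply/lfunP => w; rewrite comp_lfunE zero_lfunE.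
by apply/eqP; rewrite -memv_ker fW ?memv_proj.
Qed.

End Dual.

Section ProjectiveCurves.
Variable R : realType.
Local Notation V := 'rV[R]_3.

(* A curve in P is given by a lift c : R -> V; it represents the curve
   t |-> <[c t]>, and the lines below do not depend on the chosen lift. *)
Definition proj_point (c : R -> V) (t : R) : {vspace V} := <[c t]>%VS.

(* The 2-dimensional subspace of V whose projectivization is the tangent line. *)
Definition tangent_line (c : R -> V) (t : R) : {vspace V} :=
  (<[c t]> + <[derive1 c t]>)%VS.

(* The dimension condition says that the curve avoids 0 in V and is immersed
   in P. Periodicity is only required in P. *)
Definition closed_proj_curve (c : R -> V) : Prop :=
  [/\ smooth c,
      forall t, proj_point c (t + 1) = proj_point c t &
      forall t, (\dim (tangent_line c t) = 2)%N].

Definition dual_curve (c : R -> V) (t : R) : {vspace dual_space V} :=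
  annihilator (tangent_line c t).

Definition self_dual (c : R -> V) : Prop :=
  closed_proj_curve c /\
  exists (g : 'Hom(V, dual_space V)) (phi : R -> R),
    [/\ lker g = 0%VS,
        circle_diffeo phi &
        forall t, (g @: proj_point c (phi t))%VS = dual_curve c t].

(* The embedding u |-> <[a u]> of U in P, as the complement of a line. *)
Definition affine_chart (U : lmodType R) (a : U -> V) : Prop :=
  exists (L : {linear U -> V}) (p : V),
    [/\ injective L, forall u, L u != p & forall u, a u = L u + p].

End ProjectiveCurves.

(* Main.v *)
(** Let [det] be an area form on the plane [U], and let [phi t] be the unique
parameter in [(t, t + 1)] such that [gamma (phi t)] is a positive multiple of
[gamma' t].  In a Radon plane [gamma' (phi t)] is in turn parallel to [gamma t],
so [det (gamma t) (gamma (phi t))] has derivative zero and is a constant [k].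
On [V = U (+) R] consider the bilinear form [det u v + k r s] of [(u, r)] and
[(v, s)].  It annihilates the pairs formed by [(gamma (phi t), 1)] and either
[(gamma t, 1)] or [(gamma' t, 0)], so it sends [gamma (phi t)] to the tangent
line at [gamma t].

Implicit differentiation shows that [phi] is smooth.  No curvature of [gamma]
is needed for [phi] to be a diffeomorphism: as [k] is constant,
[gamma (phi (phi t)) = - gamma t], hence [phi^4] is the translation by an
integer. *)
Require Import Defs.
From HB Require Import structures.
From mathcomp Require Import all_boot all_order all_algebra.
From mathcomp Require Import all_classical all_reals all_analysis.
From mathcomp Require Import zify ring lra.

Set Implicit Arguments.
Unset Strict Implicit.
Unset Printing Implicit Defensive.

Import Order.TTheory GRing.Theory Num.Theory.
Import numFieldNormedType.Exports.

Local Open Scope classical_set_scope.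
Local Open Scope ring_scope.

(** * Closure properties of finitely derivable functions *)

Section FiniteSmoothness.
Variable R : realType.

(* [Ck n f] says that [f] is [n] times derivable: [Ck 0] is no condition, not
   even continuity, so that the closure lemmas go by induction on [n]. *)
Fixpoint Ck (W : normedModType R) (n : nat) (f : R -> W) : Prop :=
  if n is n'.+1 then (forall t, derivable f t 1) /\ Ck n' (derive1 f) else True.

Lemma derivable_is_derive1 (W : normedModType R) (f : R -> W) (t : R) :
  derivable f t 1 -> is_derive t 1 f (derive1 f t).
Proof. by move=> df; rewrite derive1E; exact: derivableP. Qed.

Lemma smoothP (W : normedModType R) (f : R -> W) :
  smooth f <-> forall n, Ck n f.
Proof.
split=> [sf n|sf n t].
  elim: n f sf => [//|n IH] g sg; split; first exact: (sg 0%N).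
  by apply: IH => k t; rewrite -derive1Sn; exact: sg.
elim: n f sf t => [|n IH] g cg t; first by case: (cg 1%N).
by rewrite derive1Sn; apply: IH => k; case: (cg k.+1).
Qed.

Lemma smooth_derivable (W : normedModType R) (f : R -> W) :
  smooth f -> forall t, derivable f t 1.
Proof. by move=> sf; exact: (sf 0%N). Qed.

Lemma smooth_derive1 (W : normedModType R) (f : R -> W) :
  smooth f -> smooth (derive1 f).
Proof. by move=> sf n t; rewrite -derive1Sn; exact: sf. Qed.

Lemma Ck_is_derive (W : normedModType R) n (f df : R -> W) :
  (forall t : R, is_derive t 1 f (df t)) -> Ck n df -> Ck n.+1 f.
Proof.
move=> fdf cdf; split=> [t|]; first by case: (fdf t).
suff -> : derive1 f = df by [].
by apply/funext => t; rewrite derive1E; case: (fdf t).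
Qed.

Lemma CkW (W : normedModType R) n (f : R -> W) : Ck n.+1 f -> Ck n f.
Proof. by elim: n f => // n IH f [df cf]; split=> //; exact: IH. Qed.

Lemma Ck_cst (W : normedModType R) n (w : W) : Ck n (fun=> w : W).
Proof.
elim: n w => // n IH w.
by apply: (@Ck_is_derive _ _ _ (fun=> 0)) => // t; exact: is_derive_cst.
Qed.

Lemma CkD (W : normedModType R) n (f g : R -> W) :
  Ck n f -> Ck n g -> Ck n (fun t => f t + g t).
Proof.
elim: n f g => // n IH f g [df cf] [dg cg].
apply: (@Ck_is_derive _ _ _ (fun t => derive1 f t + derive1 g t));
  last exact: IH.
by move=> t; apply: is_deriveD; exact: derivable_is_derive1.
Qed.

Lemma CkM n (f g : R -> R) :
  Ck n f -> Ck n g -> Ck n (fun t => f t * g t).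
Proof.
elim: n f g => // n IH f g /[dup] /CkW cf [df cdf] /[dup] /CkW cg [dg cdg].
apply: (@Ck_is_derive _ _ _ (fun t => f t * derive1 g t + g t * derive1 f t)).
  by move=> t; apply: is_deriveM; exact: derivable_is_derive1.
by apply: CkD; exact: IH.
Qed.

Lemma CkN n (f : R -> R) : Ck n f -> Ck n (fun t => - f t).
Proof.
move=> cf; have := CkM (Ck_cst n (-1 : R)) cf.
by under [X in Ck n X -> _]eq_fun do rewrite mulN1r.
Qed.

(** The derivative of the inverse involves the inverse itself, one order lower; hence the induction
    with [f] fixed. *)
Lemma CkV n (f : R -> R) :
  (forall t, f t != 0) -> Ck n f -> Ck n (fun t => (f t)^-1).
Proof.
move=> f0; elim: n => // n IH /[dup] /CkW /IH cV [df cdf].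
apply: (@Ck_is_derive _ _ _ (fun t => - ((f t)^-1 * (f t)^-1) * derive1 f t)).
  move=> t; apply: DeriveDef; first exact: derivableV.
  have -> := deriveV (f0 t) (df t); rewrite expr2 invfM -derive1E; reflexivity.
by apply: CkM => //; apply: CkN; exact: CkM.
Qed.

Lemma Ck_comp n (f g : R -> R) :
  Ck n f -> Ck n g -> Ck n (fun t => f (g t)).
Proof.
elim: n f g => // n IH f g [df cdf] /[dup] /CkW cg [dg cdg].
have H (t : R) : is_derive t 1 (f \o g) (derive1 f (g t) * derive1 g t).
  by apply: is_derive1_comp; exact: derivable_is_derive1.
by apply: (Ck_is_derive H); apply: CkM => //; exact: IH.
Qed.

Lemma smooth_comp (f g : R -> R) :
  smooth f -> smooth g -> smooth (fun t => f (g t)).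
Proof.
by move=> /smoothP sf /smoothP sg; apply/smoothP => n; exact: Ck_comp.
Qed.

Lemma derivable_continuous (f : R -> R) :
  (forall t, derivable f t 1) -> continuous f.
Proof. by move=> df t; exact/differentiable_continuous/derivable1_diffP. Qed.

End FiniteSmoothness.

(** * Derivatives by slope functions, and intermediate value arguments *)

Section OneVariable.
Variable R : realType.

(** A converse chain rule, for implicit differentiation: the slope of [m \o f] at [t] is the slope
    of [m] along [f] times the slope of [f], and the first factor is nonzero near [t], so one may
    divide. *)
Lemma caratheodory_factor (f m : R -> R) (t D B : R) :
  {for t, continuous f} -> is_derive (f t) 1 m D -> D != 0 ->
  is_derive t 1 (m \o f) B -> is_derive t 1 f (B / D).
Proof.
move=> cf /is_derive1_caratheodory[M [mE cM ME]] D0.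
move=> /is_derive1_caratheodory[K [kE cK KE]].
have cMf : {for t, continuous (M \o f)} by apply: continuous_comp.
have M0 : \forall s \near t, M (f s) != 0.
  apply: (cMf [set z | z != 0]); rewrite /= ME.
  exact: (@open_nbhs_nbhs _ D [set z : R | z != 0]
           (conj (@open_neq R 0) D0)).
pose h s := f t + K s / M (f s) * (s - t).
apply: (@near_eq_is_derive _ _ _ h).
  near=> s; have M1 : M (f s) != 0 by near: s.
  have e : M (f s) * (f s - f t) = K s * (s - t) by rewrite -mE -kE.
  by rewrite /h mulrAC -e mulrAC divff // mul1r addrC subrK.
apply/is_derive1_caratheodory; exists (fun s => K s / M (f s)); split.
- by move=> z; rewrite /h subrr mulr0 addr0; ring.
- apply: continuousM => //; apply: continuousV => //=; by rewrite ME.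
- by rewrite ME KE.
Unshelve. all: by end_near. Qed.

(** As [g t = 0], the slope of the product at [t] is [f] times the slope of [g], so continuity of
    [f] replaces derivability. *)
Lemma is_derive_mul_vanishing (f g : R -> R) (t D : R) :
  {for t, continuous f} -> is_derive t 1 g D -> g t = 0 ->
  is_derive t 1 (fun s => f s * g s) (f t * D).
Proof.
move=> cf /is_derive1_caratheodory[K [kE cK KE]] g0.
apply/is_derive1_caratheodory; exists (fun s => f s * K s); split.
- by move=> z; rewrite g0 mulr0 subr0 -mulrA -kE g0 subr0.
- exact: continuousM.
- by rewrite KE.
Qed.

(** Two distinct values would force a half-integer value in between. *)
Lemma continuous_integer_valued (f : R -> R) :
  continuous f -> (forall t, exists k : int, f t = k%:~R) ->
  exists k : int, forall t, f t = k%:~R.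
Proof.
move=> cf fZ; have [k0 f0] := fZ 0; exists k0 => t.
have [k fk] := fZ t; rewrite fk; congr (_%:~R); apply/eqP/negPn/negP => kk0.
wlog lt01 : f cf fZ k0 k f0 fk kk0 / (k0 < k)%R.
  move=> H; move: (kk0); rewrite neq_lt => /orP[lt|]; last first.
    by move=> lt; exact: (H f cf fZ k0 k).
  apply: (H (fun t => - f t) _ _ (- k0) (- k)).
  - by move=> s; apply: continuousN; exact: cf.
  - by move=> s; have [j ->] := fZ s; exists (- j); rewrite rmorphN.
  - by rewrite f0 rmorphN.
  - by rewrite fk rmorphN.
  - by rewrite eqr_opp.
  - by rewrite ltrN2.
have kk : (k0%:~R + 1 <= k%:~R :> R).
  by rewrite -[1]/(1%:~R) -intrD ler_int lezD1.
have cw a b : {within `[a, b], continuous f} by apply: continuous_subspaceT.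
have [c fc] : exists c, f c = k0%:~R + 1/2.
  have [t0|t0] := leP 0 t.
    have [|c _ fc] := @IVT R f 0 t (k0%:~R + 1/2) t0 (cw _ _); last by exists c.
    by rewrite f0 fk min_l ?max_r; lra.
  have [|c _ fc] := @IVT R f t 0 (k0%:~R + 1/2) (ltW t0) (cw _ _);
    last by exists c.
  by rewrite f0 fk min_r ?max_l; lra.
have [j fj] := fZ c; move: fc; rewrite fj => e.
have : (k0 < j < k0 + 1)%R.
  by rewrite -!(ltr_int R) intrD e; apply/andP; split; lra.
by lia.
Qed.

(** The existence half of the implicit function theorem. A nonzero derivative makes [G^~ t0] change
    sign at [s0]; the signs at two fixed points [s0 - r] and [s0 + r] persist for [t] near [t0], and
    a root lies between them. *)
Lemma implicit_root (G : R -> R -> R) (s0 t0 D : R) :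
  G s0 t0 = 0 -> is_derive s0 1 (G^~ t0) D -> D != 0 ->
  (forall s, {for t0, continuous (G s)}) -> (forall t, continuous (G^~ t)) ->
  forall e, 0 < e -> \forall t \near t0, exists2 s, `|s - s0| < e & G s t = 0.
Proof.
move=> G0 dG D0 cG1 cG2 e e0.
wlog D1 : G D G0 dG D0 cG1 cG2 / 0 < D.
  move=> H; move: (D0); rewrite neq_lt => /orP[Dn|]; last exact: (H G).
  apply: (@filterS _ _ _ [set t | exists2 s, `|s - s0| < e & - G s t = 0]).
    by move=> t [s se /eqP]; rewrite oppr_eq0 => /eqP Gs; exists s.
  apply: (H (fun s t => - G s t) (- D)).
  - by rewrite G0 oppr0.
  - by rewrite oppr_eq0.
  - by move=> s; apply: continuousN; exact: cG1.
  - by move=> t s; apply: continuousN; exact: cG2.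
  - by rewrite oppr_gt0.
move/is_derive1_caratheodory : dG => [K [kE cK KE]].
have : \forall s \near s0, 0 < K s.
  by apply: (cK [set z | 0 < z]); rewrite /= KE; exact: lt_nbhsr.
move=> /nbhs_ballP[d /= d0 dK].
pose r := Num.min (e / 2) (d / 2).
have r0 : 0 < r by rewrite lt_min; apply/andP; split; lra.
have re : r <= e / 2 by rewrite ge_min lexx.
have rd : r <= d / 2 by rewrite ge_min lexx orbT.
have Gp : 0 < G (s0 + r) t0.
  have := kE (s0 + r); rewrite G0 subr0 => ->.
  rewrite pmulr_lgt0; last lra.
  by apply: dK; rewrite /ball /= ltr_norml; apply/andP; split; lra.
have Gn : G (s0 - r) t0 < 0.
  have := kE (s0 - r); rewrite G0 subr0 => ->.
  rewrite pmulr_rlt0; first lra.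
  by apply: dK; rewrite /ball /= ltr_norml; apply/andP; split; lra.
near=> t.
have Gp' : 0 < G (s0 + r) t.
  by near: t; apply: (cG1 (s0 + r) [set z | 0 < z]); exact: lt_nbhsr.
have Gn' : G (s0 - r) t < 0.
  by near: t; apply: (cG1 (s0 - r) [set z | z < 0]); exact: lt_nbhsl.
have [| ||s sI Gs] := @IVT R (G^~ t) (s0 - r) (s0 + r) 0.
- lra.
- by apply: continuous_subspaceT => s; exact: cG2.
- by rewrite min_l ?max_r; lra.
exists s => //; move: sI; rewrite in_itv /= => /andP[s1 s2].
by rewrite ltr_norml; apply/andP; split; lra.
Unshelve. all: by end_near. Qed.

End OneVariable.

(** * The diffeomorphism of a Radon curve given by its two coordinates *)

Section RadonPair.
Variables (R : realType) (x y : R -> R).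
Local Notation dx := (derive1 x).
Local Notation dy := (derive1 y).

(** Determinants of two points of the curve and of a point with a velocity; [darea s t = 0] says
    that the point at [t] is orthogonal to the point at [s]. *)
Let area (s t : R) := x s * y t - y s * x t.
Let darea (s t : R) := x s * dy t - y s * dx t.
Let same_dir (s t : R) := exists l : R,
  [/\ 0 < l, x s = l * dx t & y s = l * dy t].

Hypotheses (sx : smooth x) (sy : smooth y).
Hypotheses (x1 : forall t, x (t + 1) = x t) (y1 : forall t, y (t + 1) = y t).
Hypothesis darea_neq0 : forall t, darea t t != 0.
(** What remains of the norm: the curve meets every tangent direction, and meets a ray from the
    origin at most once per period. *)
Hypothesis same_dir_ex : forall t, exists s, same_dir s t.
Hypothesis ray_inj : forall s t l : R,
  0 < l -> x s = l * x t -> y s = l * y t -> exists k : int, s = t + k%:~R.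
Hypothesis radon : forall s t, darea s t = 0 -> darea t s = 0.

Lemma periodicz (f : R -> R) : (forall t, f (t + 1) = f t) ->
  forall (k : int) t, f (t + k%:~R) = f t.
Proof.
move=> f1.
have fn (n : nat) t : f (t + n%:R) = f t.
  by elim: n => [|n IH]; rewrite ?addr0 // -natr1 addrA f1.
case=> [n|n] t; first exact: fn.
by rewrite NegzE rmorphN /= -(fn n.+1) subrK.
Qed.

Lemma derive1_periodic (f : R -> R) : (forall t, f (t + 1) = f t) ->
  (forall t, derivable f t 1) -> forall t, derive1 f (t + 1) = derive1 f t.
Proof.
move=> f1 df t; rewrite !derive1E.
have d1 := derivableP (df (t + 1)).
have ds : is_derive t 1 (fun s : R => s + 1) 1.
  by apply: is_derive_eq (addr0 _).
have H : is_derive t 1 (f \o (fun s => s + 1)) ('D_1 f (t + 1) * 1).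
  exact: is_derive1_comp.
have e : f \o (fun s => s + 1) = f by apply/funext => s /=; exact: f1.
by rewrite e in H; have [_ ->] := H; rewrite mulr1.
Qed.

Lemma same_dir_inj s s' t :
  same_dir s t -> same_dir s' t -> exists k : int, s = s' + k%:~R.
Proof.
move=> [l [l0 xs ys]] [l' [l'0 xs' ys']].
apply: (@ray_inj s s' (l / l')); first exact: divr_gt0.
  by rewrite xs xs' mulrA divfK // gt_eqF.
by rewrite ys ys' mulrA divfK // gt_eqF.
Qed.

Lemma same_dir_shift s t (k : int) : same_dir s t -> same_dir (s + k%:~R) t.
Proof. by move=> [l [l0 xs ys]]; exists l; rewrite !periodicz. Qed.

Lemma same_dir_near_uniq s s' t u : same_dir s t -> same_dir s' t ->
  u < s < u + 1 -> u < s' < u + 1 -> s = s'.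
Proof.
move=> st st' /andP[us su] /andP[us' su']; have [k e] := same_dir_inj st st'.
suff k0 : k = 0 by rewrite e k0 addr0.
have : (-1 < k < 1)%R.
  by rewrite -!(ltr_int R) rmorphN /= -[1%:~R]/(1 : R); apply/andP; split; lra.
lia.
Qed.

Lemma area_same_dir s t l : x s = l * dx t -> y s = l * dy t ->
  area t s = l * darea t t.
Proof. by move=> xs ys; rewrite /area /darea xs ys; ring. Qed.

(** The equation gives parallelism, the inequality selects the positive multiple. The inequality is
    an open condition on [(t, s)], which the continuity of [tparam] relies on. *)
Lemma same_dirP s t :
  darea s t = 0 -> 0 < area t s * darea t t -> same_dir s t.
Proof.
move=> st0 a0; have d0 := darea_neq0 t.
exists (area t s / darea t t); split.
- have -> : area t s / darea t t = area t s * darea t t / darea t t ^+ 2.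
    by rewrite expr2 invfM mulrA mulfK.
  by rewrite divr_gt0 // exprn_even_gt0.
- apply: (mulfI d0); rewrite mulrA mulrCA divff // mulr1.
  have : x t * darea s t = 0 by rewrite st0 mulr0.
  by rewrite /area /darea => e; lra.
- apply: (mulfI d0); rewrite mulrA mulrCA divff // mulr1.
  have : y t * darea s t = 0 by rewrite st0 mulr0.
  by rewrite /area /darea => e; lra.
Qed.

Lemma tparam_ex (t : R) : exists s, t < s < t + 1 /\ same_dir s t.
Proof.
have [s st] := same_dir_ex t.
pose k : int := Num.floor (s - t).
have /andP[k1 k2] := floor_itv (s - t).
rewrite -/k in k1 k2.
have := same_dir_shift (- k) st; rewrite rmorphN /= => st'.
exists (s - k%:~R); split => //; apply/andP; split; last first.
  by move: k2; rewrite intrD -[1%:~R]/(1 : R); lra.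
(* The floor only gives a weak inequality on the left; equality would make a point of the curve
   parallel to its own velocity. *)
rewrite lt_neqAle; apply/andP; split; last by lra.
apply/eqP => e; have := darea_neq0 t; have [l [l0 xs ys]] := st'.
have := area_same_dir xs ys; rewrite -e /area mulrC subrr => /esym/eqP.
by rewrite mulf_eq0 gt_eqF //= => ->.
Qed.

(* The parameter of the unit tangent direction at [t]. *)
Definition tparam (t : R) := sval (cid (tparam_ex t)).

Lemma tparam_itv t : t < tparam t < t + 1.
Proof. by case: (svalP (cid (tparam_ex t))). Qed.

Lemma tparam_dir t : same_dir (tparam t) t.
Proof. by case: (svalP (cid (tparam_ex t))). Qed.

Lemma tparam_uniq s t : same_dir s t -> t < s < t + 1 -> tparam t = s.
Proof.
by move=> st ts; exact: same_dir_near_uniq (tparam_dir t) st (tparam_itv t) ts.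
Qed.

Lemma tparam_darea t : darea (tparam t) t = 0.
Proof. by have [l [_ xs ys]] := tparam_dir t; rewrite /darea xs ys; ring. Qed.

Let cx : continuous x. Proof. exact/derivable_continuous/smooth_derivable. Qed.
Let cy : continuous y. Proof. exact/derivable_continuous/smooth_derivable. Qed.
Let sdx : smooth dx. Proof. exact: smooth_derive1. Qed.
Let sdy : smooth dy. Proof. exact: smooth_derive1. Qed.
Let cdx : continuous dx.
Proof. exact/derivable_continuous/smooth_derivable. Qed.
Let cdy : continuous dy.
Proof. exact/derivable_continuous/smooth_derivable. Qed.
Let is_dx (t : R) : is_derive t 1 x (dx t).
Proof. exact/derivable_is_derive1/smooth_derivable. Qed.
Let is_dy (t : R) : is_derive t 1 y (dy t).
Proof. exact/derivable_is_derive1/smooth_derivable. Qed.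
Let is_ddx (t : R) : is_derive t 1 dx (derive1 dx t).
Proof. exact/derivable_is_derive1/smooth_derivable. Qed.
Let is_ddy (t : R) : is_derive t 1 dy (derive1 dy t).
Proof. exact/derivable_is_derive1/smooth_derivable. Qed.

Let ddarea s t := dx s * dy t - dy s * dx t.

(** The nondegeneracy for implicit differentiation. Since the velocity at [t] is parallel to the
    point at [tparam t], this determinant is a nonzero multiple of [darea] at
    [(tparam t, tparam t)]. *)
Lemma ddarea_tparam_neq0 t : ddarea (tparam t) t != 0.
Proof.
have [l [l0 xs ys]] := tparam_dir t; apply/eqP => d0.
have /eqP := darea_neq0 (tparam t); apply; rewrite /darea xs ys.
have : l * ddarea (tparam t) t = 0 by rewrite d0 mulr0.
by rewrite /ddarea => e; lra.
Qed.

Lemma is_derive_darea (s t : R) : is_derive s 1 (darea^~ t) (ddarea s t).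
Proof.
have h1 := is_deriveM (is_dx s) (is_derive_cst (dy t) s 1).
have h2 := is_deriveM (is_dy s) (is_derive_cst (dx t) s 1).
apply: is_derive_eq (is_deriveB h1 h2) _.
rewrite !scaler0 !add0r /ddarea /cst; congr (_ - _); exact: mulrC.
Qed.

Lemma tparam_continuous : continuous tparam.
Proof.
move=> t0; set s0 := tparam t0; apply/cvgrPdist_lt => e e0.
have /andP[ts0 st0] := tparam_itv t0; rewrite -/s0 in ts0 st0.
(* Positivity of [h] tells the positive tangent direction from the opposite one. *)
pose h (z : R * R) := area z.1 z.2 * darea z.1 z.1.
have ch : continuous h.
  have c1 (f : R -> R) : continuous f -> continuous (fun z : R * R => f z.1).
    by move=> cf z; apply: continuous_comp; [exact: cvg_fst|exact: cf].
  have c2 (f : R -> R) : continuous f -> continuous (fun z : R * R => f z.2).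
    by move=> cf z; apply: continuous_comp; [exact: cvg_snd|exact: cf].
  move=> z; rewrite /continuous_at /h /area /darea.
  by apply: cvgM; apply: cvgB; apply: cvgM; (apply: c1 || apply: c2).
have h0 : 0 < h (t0, s0).
  have [l [l0 xs ys]] := tparam_dir t0.
  rewrite /h /= (area_same_dir xs ys) -mulrA pmulr_rgt0 //.
  by rewrite -expr2 exprn_even_gt0 //= darea_neq0.
have /nbhs_ballP[r /= r0 hr] : \forall z \near (t0, s0), 0 < h z.
  by apply: (ch _ [set z | 0 < z]); exact: lt_nbhsr.
(* The bound [e] is the required accuracy and [r] keeps [h] positive; the two half gaps keep [s] in
   [(t, t + 1)] while both [s] and [t] move by less than [m]. *)
pose m := Num.min (Num.min e r) (Num.min ((s0 - t0) / 2) ((t0 + 1 - s0) / 2)).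
have m0 : 0 < m by rewrite !lt_min e0 r0 /=; apply/andP; split; lra.
have [me mr ms ms'] :
    [/\ m <= e, m <= r, m <= (s0 - t0) / 2 & m <= (t0 + 1 - s0) / 2].
  by split; rewrite !ge_min lexx ?orbT.
have root := implicit_root (tparam_darea t0) (is_derive_darea _ _)
  (ddarea_tparam_neq0 t0).
near=> t.
have [s sm st] : exists2 s, `|s - s0| < m & darea s t = 0.
  near: t; apply: root => //.
    move=> s; rewrite /continuous_at /darea.
    apply: cvgB; apply: cvgM; [exact: cvg_cst|exact: cdy|exact: cvg_cst|].
    exact: cdx.
  move=> t s; rewrite /continuous_at /darea.
  apply: cvgB; apply: cvgM; [exact: cx|exact: cvg_cst|exact: cy|].
  exact: cvg_cst.
have tm : `|t - t0| < m.
  near: t; apply/nbhs_ballP; exists m => // z.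
  by rewrite /ball /= distrC.
move: (sm) (tm); rewrite !ltr_norml => /andP[sm1 sm2] /andP[tm1 tm2].
suff -> : tparam t = s by rewrite -/s0; apply/andP; split; lra.
apply: tparam_uniq; last by apply/andP; split; lra.
apply: same_dirP => //; apply: (hr (t, s)).
by split; rewrite /ball /= distrC; exact: lt_le_trans mr.
Unshelve. all: by end_near. Qed.

Let ddir s t := x s * derive1 dy t - y s * derive1 dx t.

(** Implicit differentiation of [darea (tparam t) t = 0]; [ddarea] and [ddir] are the partial
    derivatives of [darea] in its first and second argument. *)
Lemma is_derive_tparam (t : R) :
  is_derive t 1 tparam (- ddir (tparam t) t / ddarea (tparam t) t).
Proof.
apply: (caratheodory_factor (@tparam_continuous t) (is_derive_darea _ t)).
  exact: ddarea_tparam_neq0.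
have cxn : {for t, continuous (x \o tparam)}.
  by apply: continuous_comp; [exact: tparam_continuous|exact: cx].
have cyn : {for t, continuous (y \o tparam)}.
  by apply: continuous_comp; [exact: tparam_continuous|exact: cy].
have h1 := is_derive_mul_vanishing cxn
  (is_deriveB (is_ddy t) (is_derive_cst (dy t) t 1)) (subrr _).
have h2 := is_derive_mul_vanishing cyn
  (is_deriveB (is_ddx t) (is_derive_cst (dx t) t 1)) (subrr _).
(* Subtracting [darea (tparam s) s = 0] moves the variation to the second argument, where [tparam]
   enters only as a continuous factor of a function vanishing at [t]. *)
have e : darea^~ t \o tparam =
    (fun s => y (tparam s) * (dx s - dx t)) -
    (fun s => x (tparam s) * (dy s - dy t)).
  apply/funext => s.
  change (darea (tparam s) t =
    y (tparam s) * (dx s - dx t) - x (tparam s) * (dy s - dy t)).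
  have -> : darea (tparam s) t = darea (tparam s) t - darea (tparam s) s.
    by rewrite tparam_darea subr0.
  by rewrite /darea; ring.
rewrite e; apply: is_derive_eq (is_deriveB h2 h1) _.
rewrite /ddir opprB.
by congr (_ * _ - _ * _); exact: subr0.
Qed.

(** Bootstrap: the derivative is a rational expression in smooth functions of [t] and of [tparam t],
    so each order of derivability yields the next. *)
Lemma smooth_tparam : smooth tparam.
Proof.
apply/smoothP; elim=> [|n IH]; first exact: I.
apply: (Ck_is_derive is_derive_tparam).
have Cn (f : R -> R) : smooth f -> Ck n f by move/smoothP.
have Cc (f : R -> R) : smooth f -> Ck n (fun t => f (tparam t)).
  by move=> sf; apply: Ck_comp => //; exact: Cn.
have CB (f g : R -> R) : Ck n f -> Ck n g -> Ck n (fun t => f t - g t).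
  by move=> cf cg; apply: CkD => //; exact: CkN.
have sddx := smooth_derive1 sdx; have sddy := smooth_derive1 sdy.
apply: CkM; last (apply: CkV; first exact: ddarea_tparam_neq0).
  apply: CkN; apply: CB; apply: CkM.
  - exact: (Cc x).
  - exact: (Cn (derive1 dy)).
  - exact: (Cc y).
  - exact: (Cn (derive1 dx)).
apply: CB; apply: CkM.
- exact: (Cc dx).
- exact: (Cn dy).
- exact: (Cc dy).
- exact: (Cn dx).
Qed.

Lemma area_tparam_const t : area t (tparam t) = area 0 (tparam 0).
Proof.
apply: (@is_derive_0_is_cst _ (fun s => area s (tparam s))) => s.
have hx := is_derive1_comp (is_dx (tparam s)) (is_derive_tparam s).
have hy := is_derive1_comp (is_dy (tparam s)) (is_derive_tparam s).
have h := is_deriveB (is_deriveM (is_dx s) hy) (is_deriveM (is_dy s) hx).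
apply: is_derive_eq h _; rewrite /= /GRing.scale /=.
(* The derivative is [- darea (tparam s) s + N * darea s (tparam s)]; the second term vanishes by
   the Radon property. *)
set N := (- _ / _); have := radon (tparam_darea s); have := tparam_darea s.
rewrite /darea => e1 e2.
have : N * (x s * dy (tparam s) - y s * dx (tparam s)) = 0 by rewrite e2 mulr0.
by move=> e; lra.
Qed.

Lemma area_tparam_neq0 : area 0 (tparam 0) != 0.
Proof.
have [l [l0 xs ys]] := tparam_dir 0.
by rewrite (area_same_dir xs ys) mulf_neq0 // gt_eqF.
Qed.

Lemma tparam_tparam t :
  x (tparam (tparam t)) = - x t /\ y (tparam (tparam t)) = - y t.
Proof.
have [m [m0 xm ym]] := tparam_dir (tparam t).
have k0 : area t (tparam t) != 0 by rewrite area_tparam_const area_tparam_neq0.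
have e : area (tparam t) (tparam (tparam t)) = area t (tparam t).
  by rewrite !area_tparam_const.
have e' : area t (tparam (tparam t)) = 0.
  have := radon (tparam_darea t); rewrite /darea /area xm ym => d.
  have : m * (x t * dy (tparam t) - y t * dx (tparam t)) = 0 by rewrite d mulr0.
  lra.
set u := tparam (tparam t) in e e' *; set s := tparam t in k0 e *.
(* The linear relation between three plane vectors expresses the point at [u] by those at [t] and
   [s]; here [area t u = 0] and [area s u = area t s] leave the factor -1. *)
have ex : area t s * (x u + x t) = 0.
  have -> : area t s * (x u + x t) =
      (area t s - area s u) * x t + area t u * x s by rewrite /area; ring.
  by rewrite e e' subrr !mul0r addr0.
have ey : area t s * (y u + y t) = 0.
  have -> : area t s * (y u + y t) =
      (area t s - area s u) * y t + area t u * y s by rewrite /area; ring.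
  by rewrite e e' subrr !mul0r addr0.
move/eqP: ex; move/eqP: ey; rewrite !mulf_eq0 (negbTE k0) /=.
by rewrite !addr_eq0 => /eqP -> /eqP ->.
Qed.

(** The fourth iterate fixes every point of the curve, so it moves each parameter by an integer,
    constant by continuity. *)
Lemma tparam4 : exists k : int,
  forall t, tparam (tparam (tparam (tparam t))) = t + k%:~R.
Proof.
have c2 : continuous (tparam \o tparam).
  by move=> t; apply: continuous_comp; exact: tparam_continuous.
have c4 : continuous ((tparam \o tparam) \o (tparam \o tparam)).
  by move=> t; apply: continuous_comp; exact: c2.
have [|t|k nk] := @continuous_integer_valued R
    (fun t => tparam (tparam (tparam (tparam t))) - t).
- by move=> t; exact: cvgB (c4 t) cvg_id.
- have [xn yn] := tparam_tparam t.
  have [xn' yn'] := tparam_tparam (tparam (tparam t)).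
  have [||k ->] := @ray_inj (tparam (tparam (tparam (tparam t)))) t 1 ltr01.
  + by rewrite mul1r xn' xn opprK.
  + by rewrite mul1r yn' yn opprK.
  by exists k; rewrite addrC addKr.
- by exists k => t; rewrite -(nk t) addrC subrK.
Qed.

Lemma tparam_add1 t : tparam (t + 1) = tparam t + 1.
Proof.
apply: tparam_uniq; last first.
  by have /andP[h1 h2] := tparam_itv t; apply/andP; split; lra.
have [l [l0 xs ys]] := same_dir_shift 1 (tparam_dir t).
have dx1 := derive1_periodic x1 (smooth_derivable sx).
have dy1 := derive1_periodic y1 (smooth_derivable sy).
by exists l; rewrite dx1 dy1.
Qed.

Lemma tparam_circle_diffeo : circle_diffeo tparam.
Proof.
have [k nk] := tparam4.
(* A map commutes with its own fourth iterate. *)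
have nz t : tparam (t + k%:~R) = tparam t + k%:~R.
  by rewrite -(nk t) -(nk (tparam t)).
have sn := smooth_tparam.
split=> //; last by left; exact: tparam_add1.
(* The inverse is the third iterate after undoing the translation. *)
exists (fun t => tparam (tparam (tparam (t - k%:~R)))); split.
- suff st : smooth (fun t : R => t - k%:~R).
    exact: (smooth_comp sn (smooth_comp sn (smooth_comp sn st))).
  apply/smoothP => -[|n]; first exact: I.
  have h (t : R) : is_derive t 1 (fun s : R => s - k%:~R) 1.
    by apply: is_derive_eq (subr0 _).
  exact: (Ck_is_derive h (Ck_cst n (1 : R))).
- move=> t; have -> : tparam t - k%:~R = tparam (t - k%:~R).
    by rewrite -[in LHS](subrK k%:~R t) nz addrK.
  by rewrite nk subrK.
- by move=> t; rewrite nk subrK.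
Qed.

Lemma radon_diffeo : exists (phi : R -> R) (k : R),
  [/\ circle_diffeo phi, k != 0,
      forall t, x t * y (phi t) - y t * x (phi t) = k &
      forall t, exists l,
        [/\ 0 < l, x (phi t) = l * dx t & y (phi t) = l * dy t]].
Proof.
exists tparam, (area 0 (tparam 0)); split.
- exact: tparam_circle_diffeo.
- exact: area_tparam_neq0.
- exact: area_tparam_const.
- exact: tparam_dir.
Qed.

End RadonPair.

(** * Supporting directions of the norm *)

Section Flatness.
Variables (R : realType) (U : normedModType R).
Implicit Types u v w : U.

(* [w] is a direction of a supporting line at [u] of the ball of radius [`|u|].
   Only the upper estimate is kept, because it is stable under sums by
   convexity. *)
Definition flat u w := forall e : R, 0 < e ->
  exists2 d, 0 < d & forall h : R, `|h| < d -> `|u + h *: w| <= `|u| + e * `|h|.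

Lemma flatZ u w (c : R) : flat u w -> flat u (c *: w).
Proof.
move=> fuw e e0; have [->|c0] := eqVneq c 0.
  exists 1 => // h _; rewrite scale0r scaler0 addr0 lerDl.
  by rewrite mulr_ge0 // ltW.
have cp : 0 < `|c| by rewrite normr_gt0.
have [d d0 fd] := fuw (e / `|c|) (divr_gt0 e0 cp).
exists (d / `|c|); first exact: divr_gt0.
move=> h; rewrite ltr_pdivlMr // -normrM => /fd.
by rewrite scalerA normrM mulrCA divfK ?gt_eqF // (mulrC `|h|).
Qed.

Lemma flatD u v w : flat u v -> flat u w -> flat u (v + w).
Proof.
move=> fv fw e e0; have e2 : 0 < e / 2 by rewrite divr_gt0.
have [d d0 fd] := flatZ 2 fv e2; have [d' d'0 fd'] := flatZ 2 fw e2.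
exists (Num.min d d') => [|h]; first by rewrite lt_min d0.
rewrite lt_min => /andP[/fd le1 /fd' le2].
(* A midpoint of displacements by [2 *: v] and [2 *: w], to which the triangle inequality
   applies. *)
have -> : u + h *: (v + w) =
    2^-1 *: (u + h *: (2 *: v)) + 2^-1 *: (u + h *: (2 *: w)).
  rewrite -scalerDr addrACA -scalerDr -scalerDr scalerA [h * 2]mulrC -scalerA.
  rewrite -[u + u]/(u *+ 2) -(scaler_nat 2 u) -scalerDr scalerA.
  by rewrite mulVf ?scale1r.
apply: le_trans (ler_normD _ _) _; rewrite !normrZ ger0_norm ?invr_ge0 //.
have := normr_ge0 h; nra.
Qed.

Lemma flatN u w : flat (- u) w -> flat u w.
Proof.
move=> fuw e e0; have [d d0 fd] := fuw e e0; exists d => // h hd.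
have := fd (- h); rewrite !normrN => /(_ hd).
by rewrite scaleNr -opprD normrN.
Qed.

(** Along [u] the norm grows at rate [|u|], so the slack [|u| / 2] is too small. *)
Lemma not_flat_self u : u != 0 -> ~ flat u u.
Proof.
rewrite -normr_gt0 => u0 fuu; have [|d d0 fd] := fuu (`|u| / 2).
  by rewrite divr_gt0.
have := fd (d / 2); rewrite gtr0_norm; last by rewrite divr_gt0.
have -> : u + (d / 2) *: u = (1 + d / 2) *: u by rewrite scalerDl scale1r.
rewrite normrZ gtr0_norm; last lra.
by move=> /(_ _)H; have := H _; nra.
Qed.

(** The tangent point at distance [h] is within [e * |h|] of [gamma (h + t)], which has norm 1. *)
Lemma flat_derive1 (gamma : R -> U) t : derivable gamma t 1 ->
  (forall s, `|gamma s| = 1) -> flat (gamma t) (derive1 gamma t).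
Proof.
move=> dg g1 e e0.
have /cvgrPdist_lt /(_ e e0) :
    (fun h : R => h^-1 *: (gamma (h + t) - gamma t)) @ 0^' -->
      derive1 gamma t.
  rewrite derive1E; have -> : (fun h : R => h^-1 *: (gamma (h + t) - gamma t)) =
      (fun h => h^-1 *: ((gamma \o shift t) (h *: 1) - gamma t)).
    by apply/funext => h /=; rewrite [h%:A]mulr1.
  exact: dg.
rewrite near_withinE => /nbhs_ballP[d /= d0 dh]; exists d => // h hd.
have [->|h0] := eqVneq h 0; first by rewrite scale0r addr0 normr0 mulr0 addr0.
have {}dh : `|derive1 gamma t - h^-1 *: (gamma (h + t) - gamma t)| < e.
  by apply: dh => //; rewrite /ball /= sub0r normrN.
have -> : gamma t + h *: derive1 gamma t = gamma (h + t) +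
    h *: (derive1 gamma t - h^-1 *: (gamma (h + t) - gamma t)).
  by rewrite scalerBr scalerA divff // scale1r opprB addrCA
    (addrC (gamma (h + t))) subrK addrC.
apply: le_trans (ler_normD _ _) _; rewrite !g1 lerD2l normrZ mulrC.
by rewrite ler_wpM2r // ltW.
Qed.

End Flatness.

(** * Continuous linear coordinates on the plane *)

Section Plane.
Variables (R : realType) (U : normedModType R).

(** Bounds a coordinate functional. By homogeneity take [a = 1]: the constant is the distance from
    [e1] to the line of [e2], attained by compactness and nonzero by independence. *)
Lemma free_pair_bound (e1 e2 : U) :
  (forall a b : R, a *: e1 + b *: e2 = 0 -> a = 0 /\ b = 0) ->
  exists2 m : R, 0 < m & forall a b : R, m * `|a| <= `|a *: e1 + b *: e2|.
Proof.
move=> fr; pose f b := `|e1 + b *: e2|.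
have cf : continuous f.
  move=> b; apply: cvg_norm; apply: cvgD; first exact: cvg_cst.
  exact: scalel_continuous.
have e20 : 0 < `|e2|.
  rewrite normr_gt0; apply/eqP => e20.
  have [|_ /eqP] := fr 0 1; first by rewrite scale0r e20 scaler0 addr0.
  by rewrite oner_eq0.
(* Beyond [M] the term [b *: e2] has norm at least twice that of [e1], so [f b] is at least
   [f 0]. *)
pose M := 2 * `|e1| / `|e2|.
have M0 : 0 <= M by rewrite divr_ge0 // mulr_ge0.
have [|c _ fc] := @EVT_min R f (- M) M _ (continuous_subspaceT cf); first lra.
have fc0 : 0 < f c.
  rewrite normr_gt0; apply/eqP => c0.
  have [|/eqP] := fr 1 c; first by rewrite scale1r.
  by rewrite oner_eq0.
have fmin b : f c <= f b.
  have [bM|bM] := leP `|b| M; first by apply: fc; rewrite in_itv /= -ler_norml.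
  apply: (@le_trans _ _ (f 0)).
    by apply: fc; rewrite in_itv /= oppr_le0 M0.
  rewrite /f scale0r addr0.
  have : `|b *: e2| <= `|e1 + b *: e2| + `|e1|.
    rewrite -{1}(addKr e1 (b *: e2)) addrC.
    by rewrite (le_trans (ler_normB _ _)) // addrC.
  have : 2 * `|e1| <= `|b *: e2| by rewrite normrZ -ler_pdivrMr // ltW.
  lra.
exists (f c) => // a b; have [->|a0] := eqVneq a 0.
  by rewrite normr0 mulr0.
have -> : a *: e1 + b *: e2 = a *: (e1 + (b / a) *: e2).
  by rewrite scalerDr scalerA mulrCA divff // mulr1.
by rewrite normrZ mulrC ler_wpM2l // fmin.
Qed.

Lemma two_dimensional_coord : two_dimensional U ->
  exists (e1 e2 : U) (cx cy : {linear U -> R^o}),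
  [/\ continuous cx, continuous cy,
      forall u, u = cx u *: e1 + cy u *: e2 &
      forall a b : R, a *: e1 + b *: e2 = 0 -> a = 0 /\ b = 0].
Proof.
move=> [e1 [e2 E]].
have {E}[c cE] := choice E.
have cu (u : U) : u = (c u).1 *: e1 + (c u).2 *: e2 by case: (cE u).
have uniq a b : c (a *: e1 + b *: e2) = (a, b).
  by case: (cE (a *: e1 + b *: e2)) => _; exact.
have lin k u v :
    c (k *: u + v) = (k * (c u).1 + (c v).1, k * (c u).2 + (c v).2).
  rewrite -uniq; congr c; rewrite {1}(cu u) {1}(cu v).
  by rewrite scalerDr !scalerA addrACA -!scalerDl.
have lx : linear (fun u => (c u).1 : R^o) by move=> k u v; rewrite lin.
have ly : linear (fun u => (c u).2 : R^o) by move=> k u v; rewrite lin.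
pose cxL := GRing.isLinear.Build _ _ _ _ _ lx.
pose cx : {linear U -> R^o} := HB.pack (fun u => (c u).1 : R^o) cxL.
pose cyL := GRing.isLinear.Build _ _ _ _ _ ly.
pose cy : {linear U -> R^o} := HB.pack (fun u => (c u).2 : R^o) cyL.
have fr a b : a *: e1 + b *: e2 = 0 -> a = 0 /\ b = 0.
  move=> ab0; have := uniq a b; rewrite ab0.
  by have := uniq 0 0; rewrite !scale0r addr0 => -> [].
have cont (f : {linear U -> R^o}) m : 0 < m ->
    (forall u, m * `|f u| <= `|u|) -> continuous f.
  move=> m0 fb; apply: bounded_linear_continuous; apply/linear_boundedP.
  near=> r => u; apply: (@le_trans _ _ (m^-1 * `|u|)).
    by rewrite ler_pdivlMl.
  by rewrite ler_wpM2r //; near: r; exact: nbhs_pinfty_ge.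
have [m m0 mb] := free_pair_bound fr.
have [|m' m'0 mb'] := @free_pair_bound e2 e1.
  by move=> a b; rewrite addrC => /fr[].
exists e1, e2, cx, cy; split => //.
- by apply: cont m0 _ => u; rewrite [in leRHS](cu u); exact: mb.
- by apply: cont m'0 _ => u; rewrite [in leRHS](cu u) addrC; exact: mb'.
Unshelve. all: by end_near. Qed.

End Plane.

(** * Continuous linear images of derivable curves *)

Section Smoothness.
Variable R : realType.

Lemma is_derive_linear (U W : normedModType R) (l : {linear U -> W})
    (f : R -> U) (t : R) (df : U) : continuous l ->
  is_derive t 1 f df -> is_derive t 1 (l \o f) (l df).
Proof.
move=> cl [dft <-].
have dl : differentiable l (f t) by exact: linear_differentiable.
have df1 : differentiable f t by exact/derivable1_diffP.
have dlf : differentiable (l \o f) t by exact: differentiable_comp.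
apply: DeriveDef; first exact/derivable1_diffP.
by rewrite !deriveE // diff_comp // diff_lin.
Qed.

Lemma Ck_linear (U W : normedModType R) (l : {linear U -> W}) n (f : R -> U) :
  continuous l -> Ck n f -> Ck n (l \o f).
Proof.
move=> cl; elim: n f => // n IH f [df cf].
apply: (@Ck_is_derive _ _ _ _ (l \o derive1 f)); last exact: IH.
by move=> t; apply: is_derive_linear => //; exact: derivable_is_derive1.
Qed.

End Smoothness.

(** * The area form in coordinates *)

Section PlaneCoordinates.
Variables (R : realType) (U : normedModType R) (e1 e2 : U).
Variables (cx cy : {linear U -> R^o}).
Hypothesis coordE : forall u, u = cx u *: e1 + cy u *: e2.

Definition det2 (u w : U) : R := cx u * cy w - cy u * cx w.

Lemma coord_eq (u w : U) : cx u = cx w -> cy u = cy w -> u = w.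
Proof. by move=> ex ey; rewrite (coordE u) (coordE w) ex ey. Qed.

Lemma det2_colinear (u w : U) :
  w != 0 -> det2 u w = 0 -> exists l : R, u = l *: w.
Proof.
move=> w0 /eqP; rewrite /det2 subr_eq0 => /eqP e.
have [x0|x0] := eqVneq (cx w) 0; last first.
  exists (cx u / cx w); apply: coord_eq; rewrite linearZ /= /GRing.scale /=.
    by rewrite divfK.
  by rewrite mulrAC e mulfK.
have y0 : cy w != 0.
  by apply: contra w0 => /eqP y0; rewrite (coordE w) x0 y0 !scale0r addr0.
exists (cy u / cy w); apply: coord_eq; rewrite linearZ /= /GRing.scale /=.
  by rewrite mulrAC -e mulfK.
by rewrite divfK.
Qed.

Lemma det2_span (u v w : U) : det2 v w != 0 ->
  exists a b : R, u = a *: v + b *: w.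
Proof.
move=> c0; exists (det2 u w / det2 v w), (det2 v u / det2 v w).
by apply: coord_eq; rewrite linearD !linearZ /= /GRing.scale /=;
  move: c0; rewrite /det2 => c0; field.
Qed.

Lemma det2Zl (b : R) (u w : U) : det2 (b *: u) w = b * det2 u w.
Proof. by rewrite /det2 !linearZ /= /GRing.scale /=; ring. Qed.

(** Two independent supporting directions would span the plane, and [u] would be flat along itself.
    Thus a point with a flat direction has a single tangent line. *)
Lemma flat_det2 (u v w : U) : u != 0 -> flat u v -> flat u w -> det2 v w = 0.
Proof.
move=> u0 fv fw; apply/eqP/negPn/negP => c0.
have [a [b e]] := det2_span u c0; apply: (not_flat_self u0).
by rewrite {2}e; apply: flatD; apply: flatZ.
Qed.

End PlaneCoordinates.

(** * From the norm to the coordinate hypotheses *)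

Section RadonCurveDiffeo.
Variables (R : realType) (U : normedModType R) (e1 e2 : U).
Variables (cx cy : {linear U -> R^o}) (gamma : R -> U).
Hypotheses (ccx : continuous cx) (ccy : continuous cy).
Hypothesis coordE : forall u, u = cx u *: e1 + cy u *: e2.
Hypothesis radon_gamma : radon_curve gamma.
Local Notation dgamma := (derive1 gamma).
Local Notation det2 := (det2 cx cy).

Lemma radon_curve_norm t : `|gamma t| = 1.
Proof.
have [[_ _ _ _ rg] _ _] := radon_gamma.
have : range gamma (gamma t) by exists t.
by rewrite rg.
Qed.

Let gamma_neq0 t : gamma t != 0.
Proof. by rewrite -normr_gt0 radon_curve_norm. Qed.

Let sgamma : smooth gamma. Proof. by case: radon_gamma => -[]. Qed.
Let dgamma_neq0 t : dgamma t != 0. Proof. by case: radon_gamma => -[]. Qed.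

Let flat_gamma t : flat (gamma t) (dgamma t).
Proof.
by apply: flat_derive1; [exact: smooth_derivable|exact: radon_curve_norm].
Qed.

Lemma det2_derive1_neq0 t : det2 (gamma t) (dgamma t) != 0.
Proof.
apply/eqP => c0; have [l e] := det2_colinear coordE (dgamma_neq0 t) c0.
by apply: (not_flat_self (gamma_neq0 t)); rewrite {2}e; apply: flatZ.
Qed.

(* Orthogonality provides some [gamma r] equal to [gamma s] up to sign only;
   [flatN] shows that the tangents at antipodal points are parallel. *)
Lemma det2_sym0 s t :
  det2 (gamma s) (dgamma t) = 0 -> det2 (gamma t) (dgamma s) = 0.
Proof.
move=> c0; have [l e] := det2_colinear coordE (dgamma_neq0 t) c0.
have [_ _ orth] := radon_gamma.
have [|_ _ [r [a [b [sr tr]]]]] := orth (gamma t) (gamma s).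
  by split=> //; exists t, 1, l; rewrite scale1r.
have fr : flat (gamma s) (dgamma r).
  have : `|a| = 1.
    by rewrite -(radon_curve_norm s) sr normrZ radon_curve_norm mulr1.
  rewrite sr; case: (ger0P a) => _; first by move=> ->; rewrite scale1r.
  move/eqP; rewrite eqr_oppLR => /eqP ->; rewrite scaleN1r.
  by apply: flatN; rewrite opprK.
have := flat_det2 coordE (gamma_neq0 s) fr (flat_gamma s).
by move=> h; rewrite tr det2Zl h mulr0.
Qed.

Lemma radon_curve_coord_derive1 (l : {linear U -> R^o}) : continuous l ->
  derive1 (l \o gamma) = l \o dgamma.
Proof.
move=> cl; apply/funext => t; rewrite derive1E.
have dg := derivable_is_derive1 (smooth_derivable sgamma (t := t)).
by case: (is_derive_linear cl dg).
Qed.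

Lemma radon_curve_diffeo : exists (phi : R -> R) (k : R),
  [/\ circle_diffeo phi, k != 0,
      forall t, det2 (gamma t) (gamma (phi t)) = k &
      forall t, exists l : R, l != 0 /\ gamma (phi t) = l *: dgamma t].
Proof.
have [[_ _ per inj rg] _ _] := radon_gamma.
have sm (l : {linear U -> R^o}) : continuous l -> smooth (l \o gamma).
  move=> cl; apply/smoothP => n; apply: Ck_linear => //.
  by move: n; exact/smoothP.
have dxE := radon_curve_coord_derive1 ccx.
have dyE := radon_curve_coord_derive1 ccy.
have [||||||||phi [k [cphi k0 area dir]]] :=
    @radon_diffeo R (cx \o gamma) (cy \o gamma).
- exact: sm.
- exact: sm.
- by move=> t /=; rewrite per.
- by move=> t /=; rewrite per.
- by move=> t; rewrite dxE dyE; exact: det2_derive1_neq0.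
(* The normalized velocity lies on the unit circle. *)
- move=> t; have : range gamma (`|dgamma t|^-1 *: dgamma t).
    by rewrite rg /= normrZ normfV normr_id mulVf // normr_eq0.
  move=> [s _ se]; exists s, `|dgamma t|^-1; rewrite dxE dyE /= se !linearZ.
  by rewrite invr_gt0 normr_gt0.
- move=> s t l l0 /= xs ys; apply: inj.
  have e : gamma s = l *: gamma t.
    by apply: (coord_eq coordE); rewrite linearZ.
  have : `|gamma s| = `|l *: gamma t| by rewrite e.
  rewrite normrZ !radon_curve_norm mulr1 gtr0_norm // e => <-.
  by rewrite scale1r.
- by move=> s t; rewrite dxE dyE; exact: det2_sym0.
exists phi, k; split=> // t; have [l [l0 xl yl]] := dir t.
exists l; rewrite gt_eqF //; split=> //; rewrite dxE dyE /= in xl yl.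
by apply: (coord_eq coordE); rewrite linearZ.
Qed.

End RadonCurveDiffeo.

(** * The bilinear form on the linear model and its action on tangent lines *)

Section DualForm.
Variables (R : realType) (f1 f2 p : 'rV[R]_3).
Local Notation V := 'rV[R]_3.
Let X := [tuple f1; f2; p].
Hypothesis freeX : free X.

Let basisX : basis_of fullv X.
Proof. by rewrite basisEfree freeX subvf dimvf /= dim_matrix. Qed.

Let c (i : 'I_3) : 'Hom(V, R^o) := linfun (coord X i).

Lemma frame_coordE (v : V) : v = c 0 v *: f1 + c 1 v *: f2 + c 2 v *: p.
Proof.
rewrite {1}(coord_basis basisX (memvf v)) !big_ord_recl big_ord0 addr0 addrA.
have -> : lift ord0 ord0 = 1 :> 'I_3 by exact: val_inj.
have -> : lift ord0 (lift ord0 ord0) = 2 :> 'I_3 by exact: val_inj.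
by rewrite !lfunE.
Qed.

Lemma frame_coord (a b d : R) (v := a *: f1 + b *: f2 + d *: p) :
  [/\ c 0 v = a, c 1 v = b & c 2 v = d].
Proof.
pose k (i : 'I_3) := tnth [tuple a; b; d] i.
have -> : v = \sum_(i < 3) k i *: X`_i.
  by rewrite !big_ord_recl big_ord0 addr0 addrA.
by rewrite !lfunE /= !coord_sum_free.
Qed.


Lemma frame_eq0 (v : V) : c 0 v = 0 -> c 1 v = 0 -> c 2 v = 0 -> v = 0.
Proof.
by move=> v0 v1 v2; rewrite (frame_coordE v) v0 v1 v2 !scale0r !addr0.
Qed.

Section Form.
Variable k : R.
Hypothesis k0 : k != 0.

(** The form is alternating on the plane and symmetric on the line of [p], so the order of its
    arguments matters. *)
Definition polarity_fun (v : V) : dual_space V :=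
  c 0 v *: c 1 - c 1 v *: c 0 + (k * c 2 v) *: c 2.

Fact polarity_is_linear : linear polarity_fun.
Proof.
move=> a u v; apply/lfunP => w; rewrite /polarity_fun.
rewrite !(add_lfunE, opp_lfunE, scale_lfunE) !linearD !linearZ /=.
rewrite /GRing.scale /=.
ring.
Qed.

HB.instance Definition _ :=
  GRing.isLinear.Build R V (dual_space V) _ polarity_fun polarity_is_linear.

Definition polarity : 'Hom(V, dual_space V) := linfun polarity_fun.

Lemma polarityE (v w : V) :
  polarity v w = c 0 v * c 1 w - c 1 v * c 0 w + k * c 2 v * c 2 w.
Proof.
by rewrite lfunE /= /polarity_fun !(add_lfunE, opp_lfunE, scale_lfunE).
Qed.

Lemma lker_polarity : lker polarity = 0%VS.
Proof.
apply/eqP; rewrite -subv0; apply/subvP => v; rewrite memv_ker memv0 => /eqP gv.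
have g0 w : polarity v w = 0 by rewrite gv zero_lfunE.
have [a1 a2 a3] := frame_coord 1 0 0.
have [b1 b2 b3] := frame_coord 0 1 0.
have [d1 d2 d3] := frame_coord 0 0 1.
apply/eqP/frame_eq0.
- by have := g0 (0 *: f1 + 1 *: f2 + 0 *: p); rewrite polarityE b1 b2 b3; lra.
- by have := g0 (1 *: f1 + 0 *: f2 + 0 *: p); rewrite polarityE a1 a2 a3; lra.
- have := g0 (0 *: f1 + 0 *: f2 + 1 *: p); rewrite polarityE d1 d2 d3.
  rewrite !mulr0 subr0 add0r mulr1 => /eqP.
  by rewrite mulf_eq0 (negbTE k0) => /eqP.
Qed.

Lemma limg_polarity : limg polarity = fullv.
Proof.
apply/eqP; rewrite eqEdim subvf limg_dim_eq ?lker_polarity ?capv0 //.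
by rewrite !dimvf.
Qed.

Lemma annihilator_polarity (x y x' y' l : R) :
  l != 0 -> x * (l * y') - y * (l * x') = k ->
  let v := x *: f1 + y *: f2 + 1 *: p in
  let v' := x' *: f1 + y' *: f2 + 0 *: p in
  (polarity @: <[(l * x') *: f1 + (l * y') *: f2 + 1 *: p]>)%VS =
  annihilator (<[v]> + <[v']>)%VS.
Proof.
move=> l0 kE v v'; set w := _ + _ + _; rewrite limg_line.
have [w1 w2 w3] := frame_coord (l * x') (l * y') 1; rewrite -/w in w1 w2 w3.
have [v1 v2 v3] := frame_coord x y 1; rewrite -/v in v1 v2 v3.
have [v'1 v'2 v'3] := frame_coord x' y' 0; rewrite -/v' in v'1 v'2 v'3.
have annE f :
    (f \in annihilator (<[v]> + <[v']>)%VS) = (f v == 0) && (f v' == 0).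
  by rewrite mem_annihilator subv_add -!memvE !memv_ker.
apply/eqP; rewrite eqEsubv; apply/andP; split.
  rewrite -memvE annE !polarityE w1 w2 w3 v1 v2 v3 v'1 v'2 v'3 -kE.
  by apply/andP; split; apply/eqP; ring.
apply/subvP => f; rewrite annE => /andP[/eqP fv /eqP fv'].
(* By surjectivity it suffices that [u] is a multiple of [w]; as [w] has last coordinate 1, the
   factor can only be [c 2 u]. *)
have /memv_imgP[u _ fu] : f \in limg polarity by rewrite limg_polarity memvf.
rewrite fu !polarityE v1 v2 v3 v'1 v'2 v'3 in fv fv'.
apply/vlineP; exists (c 2 u); rewrite fu -linearZ; congr (polarity _).
apply/eqP; rewrite -subr_eq0; apply/eqP/frame_eq0;
  rewrite linearB linearZ /= ?w1 ?w2 ?w3 /GRing.scale /=; last by ring.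
- apply: (mulfI k0).
  (* Cramer's rule for [fv] and [fv'] as equations in [c 0 u] and [c 1 u]; their determinant times
     [l] is [k]. *)
  have -> : k * (c 0 u - c 2 u * (l * x')) =
    c 0 u * (k - (x * (l * y') - y * (l * x'))) +
    l * x * (c 0 u * y' - c 1 u * x' + k * c 2 u * 0) -
     l * x' * (c 0 u * y - c 1 u * x + k * c 2 u * 1) by ring.
  by rewrite fv fv' kE; ring.
- apply: (mulfI k0).
  have -> : k * (c 1 u - c 2 u * (l * y')) =
    c 1 u * (k - (x * (l * y') - y * (l * x'))) +
    l * y * (c 0 u * y' - c 1 u * x' + k * c 2 u * 0) -
     l * y' * (c 0 u * y - c 1 u * x + k * c 2 u * 1) by ring.
  by rewrite fv fv' kE; ring.
Qed.

End Form.

Lemma dim_tangent (x y x' y' : R) : (x' != 0) || (y' != 0) ->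
  (\dim (<[(x *: f1 + y *: f2 + 1 *: p : V)]> +
         <[(x' *: f1 + y' *: f2 + 0 *: p : V)]>) = 2)%N.
Proof.
move=> nz; set v := (X in <[X]>%VS); set v' := (X in (_ + <[X]>)%VS).
have [v1 v2 v3] := frame_coord x y 1; rewrite -/v in v1 v2 v3.
have [v'1 v'2 v'3] := frame_coord x' y' 0; rewrite -/v' in v'1 v'2 v'3.
have : free [:: v; v'].
  rewrite free_cons seq1_free span_seq1; apply/andP; split.
    apply/vlineP => -[d vd]; have := v3; rewrite vd linearZ /= v'3 scaler0.
    by move/eqP; rewrite eq_sym oner_eq0.
  by apply: contraL nz => /eqP v'0; rewrite -v'1 -v'2 v'0 !linear0 eqxx.
by rewrite /free span_cons span_seq1 => /eqP.
Qed.

End DualForm.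

(** * The curve in an arbitrary affine chart *)

Theorem proposition21 (R : realType) (U : normedModType R)
    (a : U -> 'rV[R]_3) (gamma : R -> U) :
  two_dimensional U -> affine_chart a -> radon_curve gamma ->
  self_dual (fun t : R => a (gamma t)).
Proof.
move=> U2 [L [p [Linj Lp aE]]] rg.
have [e1 [e2 [cx [cy [ccx ccy coordE fr]]]]] := two_dimensional_coord U2.
have [phi [k [cphi k0 area dir]]] := radon_curve_diffeo ccx ccy coordE rg.
have [[sg dg0 per _ _] _ _] := rg.
have LE u : L u = cx u *: L e1 + cy u *: L e2.
  by rewrite {1}(coordE u) linearD !linearZ.
have freeX : free [tuple L e1; L e2; p].
  apply/freeP => m; rewrite !big_ord_recl big_ord0 addr0 /= addrA => m0.
  have m2 : m (lift ord0 (lift ord0 ord0)) = 0.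
    apply/eqP/negPn/negP => m2.
    (* Solving the relation for [p] would put it in the image of [L]. *)
    pose z := - (m (lift ord0 (lift ord0 ord0)))^-1.
    have /eqP := Lp (z *: (m ord0 *: e1 + m (lift ord0 ord0) *: e2)); apply.
    rewrite linearZ linearD !linearZ /=.
    move/eqP: m0; rewrite addr_eq0 => /eqP ->.
    by rewrite scalerN -scaleNr opprK scalerA mulVf // scale1r.
  have [m0' m1'] : m ord0 = 0 /\ m (lift ord0 ord0) = 0.
    apply: fr; apply: Linj; rewrite linear0 linearD !linearZ /=.
    by move: m0; rewrite m2 scale0r addr0.
  case=> -[|[|[|//]]] i.
  - by rewrite -[RHS]m0'; congr m; exact: val_inj.
  - by rewrite -[RHS]m1'; congr m; exact: val_inj.
  - by rewrite -[RHS]m2; congr m; exact: val_inj.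
(* The chart is only assumed linear; continuity comes from that of the coordinates. *)
have cL : continuous L.
  have -> : (L : U -> _) = (fun u => cx u *: L e1 + cy u *: L e2).
    exact/funext/LE.
  move=> u; apply: cvgD.
    apply: (@continuous_comp _ _ _ cx (fun z : R => z *: L e1)).
      exact: ccx.
    exact: scalel_continuous.
  apply: (@continuous_comp _ _ _ cy (fun z : R => z *: L e2)).
    exact: ccy.
  exact: scalel_continuous.
have curveE t : a (gamma t) =
    cx (gamma t) *: L e1 + cy (gamma t) *: L e2 + 1 *: p.
  by rewrite aE LE scale1r.
have curveLE : (fun t => a (gamma t)) = (fun t => (L \o gamma) t + p).
  by apply/funext => t; rewrite aE.
have scurve : smooth (fun t => a (gamma t)).
  rewrite curveLE; apply/smoothP => n; apply: CkD; last exact: Ck_cst.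
  by apply: Ck_linear => //; move: n; exact/smoothP.
(* In the frame, points of the curve have last coordinate 1 and velocities 0, the shape expected by
   [annihilator_polarity]. *)
have curve'E t : derive1 (fun t => a (gamma t)) t =
    cx (derive1 gamma t) *: L e1 + cy (derive1 gamma t) *: L e2 + 0 *: p.
  have dg := derivable_is_derive1 (smooth_derivable sg (t := t)).
  have [_ e] := is_deriveD (is_derive_linear cL dg) (is_derive_cst p t 1).
  by rewrite derive1E curveLE e addr0 scale0r addr0; exact: LE.
split.
  split=> // t; first by rewrite /proj_point per.
  rewrite /tangent_line curve'E curveE; apply: dim_tangent => //.
  apply: contraT; rewrite negb_or !negbK => /andP[/eqP x0 /eqP y0].
  have := dg0 t; rewrite (coordE (derive1 gamma t)) x0 y0 !scale0r addr0.
  by rewrite eqxx.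
exists (polarity (L e1) (L e2) p k), phi; split=> //.
  exact: lker_polarity.
move=> t; rewrite /dual_curve /tangent_line /proj_point curve'E !curveE.
have [l [l0 gl]] := dir t.
have xl : cx (gamma (phi t)) = l * cx (derive1 gamma t) by rewrite gl linearZ.
have yl : cy (gamma (phi t)) = l * cy (derive1 gamma t) by rewrite gl linearZ.
rewrite xl yl; apply: annihilator_polarity => //.
by rewrite -xl -yl; exact: area.
Qed.
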